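(* Let $P\subset\mathbb{R}^d$ be a full-dimensional centrally symmetric polytope and let $F,G$ be facets of $P$. Then $$\mathcal{B}_{F,G}=\operatorname{cone}\left(\{v-u : v\in\operatorname{vert}(F),\ u\in\operatorname{vert}(G)\}\right).$$
   Context: $P=-P$ is a full-dimensional convex polytope in $\mathbb{R}^d$ (so the origin is in its interior). Its distance function is $\operatorname{dist}(a,b)=\min\{\alpha\ge 0 : b-a\in\alpha P\}$. For $a,b\in\mathbb{R}^d$ the bisector is $\operatorname{bis}(a,b)=\{x\in\mathbb{R}^d:\operatorname{dist}(a,x)=\operatorname{dist}(b,x)\}$. For a facet $F$ of $P$, $C_F=\operatorname{cone}(F)$ is the set of all finite nonnegative linear combinations of points of $F$. For facets $F,G$, $\operatorname{bis}_{F,G}(a,b)=\operatorname{bis}(a,b)\cap(C_F+a)\cap(C_G+b)$. The bisection cone is $\mathcal{B}_{F,G}=\{x\in\mathbb{R}^d:\operatorname{bis}_{F,G}(0,x)\neq\emptyset\}$. $\operatorname{vert}(F)$ denotes the set of vertices of $F$, and $\operatorname{cone}(S)$ the set of all finite nonnegative linear combinations of elements of $S$. *)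

(* Defs.v *)
From mathcomp Require Import all_boot all_order all_algebra.
From mathcomp Require Import boolp classical_sets reals.

Set Implicit Arguments.
Unset Strict Implicit.
Unset Printing Implicit Defensive.

Import Order.TTheory GRing.Theory Num.Theory.

Local Open Scope classical_set_scope.
Local Open Scope ring_scope.

Section Polytopes.
Context {R : realType} {d : nat}.
Local Notation E := 'rV[R]_d.
Implicit Types (S P F G : set E) (a b c x : E).

Definition aff S : set E := [set x | exists (n : nat) (l : 'I_n -> R) (p : 'I_n -> E),
  [/\ forall i, S (p i), \sum_i l i = 1 & x = \sum_i l i *: p i]].

Definition conv S : set E := [set x | exists (n : nat) (l : 'I_n -> R) (p : 'I_n -> E),
  [/\ forall i, S (p i), forall i, 0 <= l i, \sum_i l i = 1
    & x = \sum_i l i *: p i]].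

(* The empty combination (n = 0) is allowed, so cone set0 = [set 0]. *)
Definition cone S : set E := [set x | exists (n : nat) (l : 'I_n -> R) (p : 'I_n -> E),
  [/\ forall i, S (p i), forall i, 0 <= l i & x = \sum_i l i *: p i]].

(* The dimension of S is that of its affine hull x0 + V, and dim set0 = -1. *)
Definition has_dim S (k : int) : Prop :=
  (S = set0 /\ k = -1) \/
  exists (x0 : E) (V : {vspace E}),
    aff S = [set x | exists2 v, v \in V & x = x0 + v] /\ k = (\dim V)%:Z.

Definition polytope P : Prop := exists s : seq E, P = conv [set` s].

Definition dot c x : R := \sum_i c 0 i * x 0 i.

(* With c = 0 this makes P itself and the empty set faces of P. *)
Definition face P F : Prop := exists (c : E) (beta : R),
  (forall x, P x -> dot c x <= beta) /\ F = P `&` [set x | dot c x = beta].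

Definition facet P F : Prop :=
  face P F /\ exists k : int, has_dim P k /\ has_dim F (k - 1).

Definition vert P : set E := [set v | face P [set v]].

Definition translate S a : set E := [set x + a | x in S].

(* xget 0 picks the minimum, unique when it exists; 0 is a junk value otherwise. *)
Definition minimum (A : set R) : R := xget 0 [set m | A m /\ lbound A m].

Definition dist P a b : R :=
  minimum [set alpha | 0 <= alpha /\ [set alpha *: p | p in P] (b - a)].

Definition bis P a b : set E := [set x | dist P a x = dist P b x].

Definition bisFG P F G a b : set E :=
  bis P a b `&` translate (cone F) a `&` translate (cone G) b.

Definition bisection_cone P F G : set E := [set x | bisFG P F G 0 x !=set0].

End Polytopes.

(* Main.v *)
(** A facet [F] spans a hyperplane [c . x = 1] supporting [P], and on the cone
    over [F] the distance from the origin is the linear form [c]: a conic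
    combination of points of [F] with total weight [t] has distance [t].  Hence
    [x] is in the bisection cone iff [x = y - z] where [y] and [z] are conic
    combinations, of equal total weight, of points of [F] and of [G].  The
    points may be taken to be vertices, since the cone over [F] is generated by
    an irredundant finite subset of [F], whose elements are exposed by Farkas'
    lemma.  Finally [t (y - z) = \sum_ij l_i m_j (v_i - u_j)] when
    [y = \sum_i l_i v_i], [z = \sum_j m_j u_j] and both weights sum to [t]. *)
Require Import Defs.
From mathcomp Require Import all_boot all_order all_algebra.
From mathcomp Require Import boolp classical_sets reals.
From mathcomp Require Import lra.

Import Order.TTheory GRing.Theory Num.Theory.

Local Open Scope classical_set_scope.
Local Open Scope ring_scope.

Section BisectionCone.
Context {R : realType} {d : nat}.
Local Notation E := 'rV[R]_d.
Implicit Types (S T P F G : set E) (a b c p u v x y z : E) (s : seq E).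

(** * Bilinearity and positivity of the dot product *)

Lemma dotDr c x y : dot c (x + y) = dot c x + dot c y.
Proof. by rewrite /dot -big_split; apply: eq_bigr => i _; rewrite mxE mulrDr. Qed.

Lemma dotZr c (l : R) x : dot c (l *: x) = l * dot c x.
Proof. by rewrite /dot mulr_sumr; apply: eq_bigr => i _; rewrite mxE mulrCA. Qed.

Lemma dotC c x : dot c x = dot x c.
Proof. by apply: eq_bigr => i _; rewrite mulrC. Qed.

Lemma dotNr c x : dot c (- x) = - dot c x.
Proof. by rewrite -scaleN1r dotZr mulN1r. Qed.

Lemma dot0r c : dot c 0 = 0.
Proof. by rewrite -[0 in LHS](scale0r 0) dotZr mul0r. Qed.

Lemma dot_gt0 b : b != 0 -> 0 < dot b b.
Proof.
move=> /rV0Pn[i bi]; rewrite /dot (bigD1 i) //=.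
rewrite ltr_pwDl ?sumr_ge0 // => [|j _]; last by rewrite -expr2 sqr_ge0.
by rewrite -expr2 lt_neqAle sqr_ge0 eq_sym sqrf_eq0 bi.
Qed.

(** * Conic combinations with their total weight *)

(** The weight [t] is recorded because it becomes the distance on the cone over a facet. For [t = 1]
    this is [conv S]. *)
Definition conic S (t : R) x := exists (n : nat) (l : 'I_n -> R) (p : 'I_n -> E),
  [/\ forall i, S (p i), forall i, 0 <= l i, \sum_i l i = t
    & x = \sum_i l i *: p i].

Lemma coneP S x : cone S x <-> exists t, conic S t x.
Proof.
split=> [[n [l [p [Sp l0 ->]]]]|[t [n [l [p [Sp l0 _ ->]]]]]]; last by exists n, l, p.
by exists (\sum_i l i), n, l, p.
Qed.

Lemma conic_ind S (Q : R -> E -> Prop) : Q 0 0 ->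
  (forall (l t : R) p x, S p -> 0 <= l -> Q t x -> Q (l + t) (l *: p + x)) ->
  forall t x, conic S t x -> Q t x.
Proof.
move=> Q0 QD t x [n [l [p [Sp l0 <- ->]]]].
elim: n l p Sp l0 => [|n IHn] l p Sp l0; first by rewrite !big_ord0.
by rewrite !big_ord_recl; apply: QD => //; apply: IHn.
Qed.

Lemma conic0 S : conic S 0 0.
Proof.
by exists 0%N, (fun=> 0), (fun=> 0); split=> [[]|[]||] //; rewrite big_ord0.
Qed.

Lemma conic_cons S (l t : R) p x :
  S p -> 0 <= l -> conic S t x -> conic S (l + t) (l *: p + x).
Proof.
move=> Sp l0 [n [m [q [Sq m0 <- ->]]]].
exists n.+1, (fun i => oapp m l (unlift ord0 i)), (fun i => oapp q p (unlift ord0 i)).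
split=> [i|i||]; rewrite ?big_ord_recl ?unlift_none /=.
- by case: unliftP => [j|] _ /=.
- by case: unliftP => [j|] _ /=.
- by under eq_bigr => i _ do rewrite liftK.
- by under [in RHS]eq_bigr => i _ do rewrite liftK.
Qed.

Lemma conic1 S p : S p -> conic S 1 p.
Proof.
by move=> Sp; have := conic_cons _ _ _ _ _ Sp ler01 (conic0 S); rewrite scale1r !addr0.
Qed.

Lemma conicD S (t r : R) x y : conic S t x -> conic S r y -> conic S (t + r) (x + y).
Proof.
move=> Sx Sy; move: t x Sx; apply: conic_ind => [|l t p x Sp l0 IH]; first by rewrite !add0r.
by rewrite -!addrA; apply: conic_cons.
Qed.

Lemma conicZ S (k t : R) x : 0 <= k -> conic S t x -> conic S (k * t) (k *: x).
Proof.
move=> k0; move: t x; apply: conic_ind => [|l t p x Sp l0 IH].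
  by rewrite mulr0 scaler0; apply: conic0.
by rewrite mulrDr scalerDr scalerA; apply: conic_cons => //; apply: mulr_ge0.
Qed.

Lemma conic_bind S T : (forall p, S p -> conic T 1 p) ->
  forall (t : R) x, conic S t x -> conic T t x.
Proof.
move=> ST; apply: conic_ind => [|l t p x Sp l0 IH]; first exact: conic0.
by apply: conicD => //; have := conicZ _ _ _ _ l0 (ST _ Sp); rewrite mulr1.
Qed.

Lemma conic_ge0 S (t : R) x : conic S t x -> 0 <= t.
Proof. by move=> [n [l [p [_ l0 <- _]]]]; apply: sumr_ge0. Qed.

Lemma conic_weight0 S x : conic S 0 x -> x = 0.
Proof.
move=> [n [l [p [_ l0 /eqP + ->]]]].
rewrite psumr_eq0 // => /allP l00; apply: big1 => i _.
by have /eqP-> := l00 i (mem_index_enum i); rewrite scale0r.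
Qed.

Lemma dot_conic S c : (forall p, S p -> dot c p = 1) ->
  forall (t : R) x, conic S t x -> dot c x = t.
Proof.
move=> S1; apply: conic_ind => [|l t p x Sp l0 IH]; first exact: dot0r.
by rewrite dotDr dotZr S1 // IH mulr1.
Qed.

Lemma cone0 S : cone S 0.
Proof. by apply/coneP; exists 0; apply: conic0. Qed.

Lemma sub_cone S x : S x -> cone S x.
Proof. by move=> Sx; apply/coneP; exists 1; apply: conic1. Qed.

Lemma coneD S x y : cone S x -> cone S y -> cone S (x + y).
Proof.
by move=> /coneP[t Sx] /coneP[r Sy]; apply/coneP; exists (t + r); apply: conicD.
Qed.

Lemma coneZ S (k : R) x : 0 <= k -> cone S x -> cone S (k *: x).
Proof. by move=> k0 /coneP[t Sx]; apply/coneP; exists (k * t); apply: conicZ. Qed.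

Lemma cone_min S T : S `<=` cone T -> cone S `<=` cone T.
Proof.
move=> ST x /coneP[t]; move: t x; apply: conic_ind => [|l t p x Sp l0 IH].
  exact: cone0.
by apply: coneD => //; apply: coneZ => //; apply: ST.
Qed.

(** * Farkas' lemma and generation of the cone over a facet by vertices *)

(* The list is projected along [a] to the kernel of the separating form [c] of
   the tail; [f] does not leave [cone (a :: s)] because [c] is nonpositive on
   [s] and positive at [a]. *)
Lemma farkas s b : ~ cone [set` s] b ->
  exists c, (forall a, a \in s -> dot c a <= 0) /\ 0 < dot c b.
Proof.
have [n] := ubnP (size s); elim: n s b => // n IHn [|a s] b /= sn nb.
  exists b; split=> //; apply: dot_gt0; apply/eqP => b0.
  by apply: nb; rewrite b0; apply: cone0.
have s_as : cone [set` s] `<=` cone [set` a :: s].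
  by apply: cone_min => x /= xs; apply: sub_cone; rewrite /= inE xs orbT.
have aP : cone [set` a :: s] a by apply: sub_cone; rewrite /= mem_head.
have [c [cs cb]] := IHn s b sn (fun h => nb (s_as _ h)).
have [ca|ca] := lerP (dot c a) 0.
  by exists c; split=> // x; rewrite inE => /orP[/eqP->|/cs].
pose f x := x - (dot c x / dot c a) *: a.
have nfb : ~ cone [set` map f s] (f b).
  move=> fb; apply: nb; rewrite -(subrK ((dot c b / dot c a) *: a) b).
  apply: coneD; last by apply: coneZ => //; rewrite ltW // divr_gt0.
  move: fb; apply: cone_min => _ /= /mapP[x xs ->].
  apply: coneD; first by apply/s_as/sub_cone.
  rewrite -scaleNr -mulNr; apply: coneZ => //.
  by rewrite divr_ge0 ?oppr_ge0 ?cs // ltW.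
have [|e [es eb]] := IHn (map f s) (f b) _ nfb; first by rewrite size_map.
(* Composing [e] with the projection [f] gives a linear form again, and it vanishes at [a] because
   [f a = 0]. *)
have ef x : dot (e - (dot e a / dot c a) *: c) x = dot e (f x).
  rewrite dotC !dotDr !dotNr !dotZr (dotC x e) (dotC x c).
  by rewrite mulrAC [in RHS]mulrAC [dot c x * _]mulrC.
exists (e - (dot e a / dot c a) *: c); split; last by rewrite ef.
move=> x; rewrite ef inE => /orP[/eqP->|xs]; last by apply: es; apply: map_f.
by rewrite /f divff ?gt_eqF // scale1r subrr dot0r.
Qed.

(** Deleting a generator that lies in the cone of the remaining ones does not change the cone; the
    process stops because the list gets shorter. *)
Lemma irredundant_generators s : exists s',
  [/\ {subset s' <= s}, [set` s] `<=` cone [set` s']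
    & forall v, v \in s' -> ~ cone [set` rem v s'] v].
Proof.
have [n] := ubnP (size s); elim: n s => // n IHn s sn.
have [[v [vs vr]]|nex] := pselect (exists v, v \in s /\ cone [set` rem v s] v).
  have [|s' [s's ss' irr]] := IHn (rem v s).
    by rewrite size_rem //; case: (s) vs sn.
  exists s'; split=> // [x /s's/mem_rem//|x /= xs].
  move: (cone_min _ _ ss'); apply; have [->//|xv] := eqVneq x v.
  by apply: sub_cone; move: xs; rewrite /= (perm_mem (perm_to_rem vs)) inE (negPf xv).
exists s; split=> //; first by move=> x; apply: sub_cone.
by move=> v vs vr; apply: nex; exists v.
Qed.

Lemma conic_rem s v (t : R) x : v \in s -> conic [set` s] t x ->
  exists (l r : R) y, [/\ 0 <= l, conic [set` rem v s] r y, t = l + r & x = l *: v + y].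
Proof.
move=> vs; move: t x; apply: conic_ind => [|k t p x /= ps k0 [l [r [y [l0 ry -> ->]]]]].
  by exists 0, 0, 0; split=> //; rewrite ?scale0r ?addr0 //; apply: conic0.
have [->|pv] := eqVneq p v.
  by exists (k + l), r, y; rewrite addr_ge0 // scalerDl !addrA.
exists l, (k + r), (k *: p + y); split=> //; rewrite 1?addrCA //.
by apply: conic_cons => //; move: ps; rewrite /= (perm_mem (perm_to_rem vs)) inE (negPf pv).
Qed.

(** Farkas gives [e] nonpositive on the other generators and positive at [v]. A point of [F] has
    total weight 1, so it is [l *: v + y] with [l <= 1] and [dot e y <= 0]. Hence [e] is at most
    [dot e v] on [F], and equality forces [l = 1] and [y = 0]: the form [e] exposes [v]. *)
Lemma vert_irredundant F c s v : (forall x, F x -> dot c x = 1) ->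
  [set` s] `<=` F -> F `<=` cone [set` s] -> v \in s ->
  ~ cone [set` rem v s] v -> vert F v.
Proof.
move=> F1 sF Fs vs /farkas[e [er ev]].
have key x : F x -> exists l y, [/\ l <= 1, l = 1 -> y = 0, x = l *: v + y & dot e y <= 0].
  move=> Fx; have /coneP[t tx] := Fs _ Fx.
  have t1 : t = 1.
    by rewrite -(F1 _ Fx); apply/esym; move: tx; apply: dot_conic => p /sF/F1.
  have [l [r [y [l0 ry tE ->]]]] := conic_rem _ _ _ _ vs tx.
  exists l, y; split=> //.
  - by have := conic_ge0 _ _ _ ry; lra.
  - move=> l1; have r0 : r = 0 by lra.
    by move: ry; rewrite r0 => /conic_weight0.
  - move: r y {tE} ry; apply: conic_ind => [|k r p y pr k0 IH]; first by rewrite dot0r.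
    by rewrite dotDr dotZr; have := er _ pr; nra.
exists e, (dot e v); split=> [x /key[l [y [l1 _ -> y0]]]|].
  by rewrite dotDr dotZr; nra.
apply/seteqP; split=> [_ ->|x [/key[l [y [l1 ly -> y0]]]]] /=.
  by split=> //; apply: sF.
rewrite dotDr dotZr => eE; have l1' : l = 1 by apply/eqP; rewrite eq_le l1 /=; nra.
by rewrite ly // l1' scale1r addr0.
Qed.

Lemma cone_face P F c : polytope P -> (forall x, P x -> dot c x <= 1) ->
  F = P `&` [set x | dot c x = 1] -> cone F `<=` cone (vert F).
Proof.
move=> [s PE] P1 FE.
have sP p : p \in s -> P p by rewrite PE => ps; apply: conic1.
have F1 x : F x -> dot c x = 1 by rewrite FE => -[].
pose s0 := [seq p <- s | dot c p == 1].
have s0F : [set` s0] `<=` F.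
  by move=> p /=; rewrite mem_filter FE => /andP[/eqP c1 /sP Pp].
have Fs0 : F `<=` cone [set` s0].
  move=> x Fx; have Px : conic [set` s] 1 x by move: Fx; rewrite FE PE => -[].
  (* The induction replaces 1 by the weight [t]: a combination of weight [t] has [dot c x <= t], and
     equality forces every term with a positive coefficient onto the hyperplane. *)
  have : dot c x <= 1 /\ (dot c x = 1 -> cone [set` s0] x).
    move: (1 : R) x Px {Fx}; apply: conic_ind => [|l t p x ps l0 [xt IH]].
      by rewrite dot0r; split=> // _; apply: cone0.
    have p1 := P1 _ (sP _ ps); rewrite dotDr dotZr; split=> [|xE]; first by nra.
    apply: coneD; last by apply: IH; nra.
    have [->|l_neq0] := eqVneq l 0; first by rewrite scale0r; apply: cone0.
    apply: coneZ => //; apply: sub_cone; rewrite /= mem_filter ps andbT.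
    have l_gt0 : 0 < l by rewrite lt_neqAle eq_sym l_neq0.
    by apply/eqP/le_anti; rewrite p1 /=; nra.
  by move=> [_]; apply; apply: F1.
have [s' [s's0 s0s' irr]] := irredundant_generators s0.
have Fs' : F `<=` cone [set` s'] by move=> x /Fs0; apply: cone_min.
have s'F : [set` s'] `<=` F by move=> x /s's0/s0F.
move=> x /(cone_min _ _ Fs'); apply: cone_min => v /= vs; apply: sub_cone.
by apply: (vert_irredundant _ c s') => //; apply: irr.
Qed.

(** * Dimension, facet normals and the distance function *)

(** This excludes an empty [P] and a facet equal to [P]. The two clauses of [has_dim] exclude each
    other, since an empty sum is not 1, and an affine subspace determines its direction space. *)
Lemma has_dim_uniq S (k k' : int) : has_dim S k -> has_dim S k' -> k = k'.
Proof.
have aff0 : aff (set0 : set E) = set0.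
  apply/seteqP; split=> // x [[|n] [l [p [Sp]]]]; last by case: (Sp ord0).
  by rewrite big_ord0 => /eqP; rewrite eq_sym oner_eq0.
have affN0 x0 (V : {vspace E}) : set0 <> [set x | exists2 v, v \in V & x = x0 + v].
  by move=> /seteqP[_ /(_ x0)]; apply; exists 0; rewrite ?mem0v ?addr0.
have subV x0 x1 (V W : {vspace E}) :
    [set x | exists2 v, v \in V & x = x0 + v] = [set x | exists2 v, v \in W & x = x1 + v] ->
    (V <= W)%VS.
  move=> /seteqP[VW _]; apply/subvP => v vV.
  have [|w wW xE] := VW x0; first by exists 0; rewrite ?mem0v ?addr0.
  have [|w' w'W] := VW (x0 + v); first by exists v.
  rewrite xE -addrA => /addrI wv.
  by rewrite -(addKr w v) wv addrC; apply: memvB.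
move=> [[S0 ->]|[x0 [V [SV ->]]]] [[S0' ->]|[x1 [W [SW ->]]]] //.
- by case: (affN0 x1 W); rewrite -SW S0 aff0.
- by case: (affN0 x0 V); rewrite -SV S0' aff0.
- rewrite SV in SW; congr (Posz (\dim _)); apply/eqP; rewrite eqEsubv.
  by rewrite (subV _ _ _ _ SW) (subV _ _ _ _ (esym SW)).
Qed.

(* The empty set is a facet when d = 0; there c = 0 works. *)
Lemma facet_normal P F : [set - x | x in P] = P -> P !=set0 -> facet P F ->
  exists c, (forall x, P x -> dot c x <= 1) /\ F = P `&` [set x | dot c x = 1].
Proof.
move=> symP [x0 Px0] [[c [beta [Pc FE]]] [k [Pk Fk]]].
have symPx x : P x -> P (- x) by move=> Px; rewrite -symP; exists x.
have [F0|F_neq0] := pselect (F = set0).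
  exists 0; split=> [x _|]; first by rewrite dotC dot0r ler01.
  rewrite F0; apply/seteqP; split=> // x [_] /=.
  by rewrite dotC dot0r => /eqP; rewrite eq_sym oner_eq0.
have Pabs x : P x -> - beta <= dot c x <= beta.
  by move=> Px; rewrite Pc // lerNl -dotNr Pc //; apply: symPx.
(* By symmetry, [beta = 0] would make [c] vanish on [P], so that [F = P], against the drop in
   dimension. Dividing by [beta] then normalizes the form. *)
have beta_gt0 : 0 < beta.
  have beta_ge0 : 0 <= beta by have /andP[] := Pabs _ Px0; lra.
  rewrite lt_neqAle beta_ge0 andbT; apply/eqP => beta0.
  have FP : F = P.
    rewrite FE; apply/seteqP; split=> [x []//|x Px]; split=> //=.
    by apply/eqP; rewrite eq_le; have := Pabs _ Px; rewrite -beta0 oppr0 andbC.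
  rewrite FP in Fk; have /eqP := has_dim_uniq _ _ _ Pk Fk.
  by rewrite -subr_eq0 opprB addrC subrK.
have dotE x : dot (beta^-1 *: c) x = dot c x / beta.
  by rewrite dotC dotZr mulrC dotC.
exists (beta^-1 *: c); split=> [x Px|].
  by rewrite dotE ler_pdivrMr // mul1r Pc.
rewrite FE; apply/seteqP; split=> x [Px] /=; rewrite dotE => cx; split=> //=.
  by rewrite cx divff ?gt_eqF.
by rewrite -[LHS](divfK (lt0r_neq0 beta_gt0)) cx mul1r.
Qed.

(** The value [t] is attained because [b - a] divided by [t] is a convex combination of points of
    [F]. It is minimal because [b - a = r *: p] with [p] in [P] gives [t = r * dot c p <= r]. *)
Lemma dist_conic P F c : polytope P -> P !=set0 ->
  (forall x, P x -> dot c x <= 1) -> F = P `&` [set x | dot c x = 1] ->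
  forall (t : R) a b, conic F t (b - a) -> dist P a b = t.
Proof.
move=> [s PE] [x0 Px0] P1 FE t a b Ft.
have t0 := conic_ge0 _ _ _ Ft.
have F1 p : F p -> dot c p = 1 by rewrite FE => -[].
have cE := dot_conic _ _ F1 _ _ Ft.
pose A := [set alpha : R | 0 <= alpha /\ [set alpha *: p | p in P] (b - a)].
have At : A t.
  split=> //=; have [t_eq0|t_neq0] := eqVneq t 0.
    (* For [t = 0] the difference [b - a] is 0, and any point of [P] scaled by 0 represents it. *)
    exists x0 => //; move: Ft; rewrite t_eq0 => /conic_weight0->; exact: scale0r.
  exists (t^-1 *: (b - a)); last by rewrite scalerA divff // scale1r.
  have : conic F 1 (t^-1 *: (b - a)) by rewrite -(mulVf t_neq0); apply: conicZ; rewrite ?invr_ge0.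
  by rewrite PE; apply: conic_bind => p; rewrite FE PE => -[].
have tA : lbound A t.
  by move=> r [r0 [p Pp pE]]; rewrite -cE -pE dotZr; have := P1 _ Pp; nra.
rewrite /dist /minimum; apply: xget_unique => // r [Ar rA].
by apply/eqP; rewrite eq_le rA //= tA.
Qed.

(** * Differences of combinations of equal weight, and the bisection cone *)

Lemma cone_sub S T (t : R) y z : conic S t y -> conic T t z ->
  cone [set v - u | v in S & u in T] (y - z).
Proof.
move=> Sy Tz; have t0 := conic_ge0 _ _ _ Tz.
set D := [set _ | _ in S & _ in T].
have [t_eq0|t_neq0] := eqVneq t 0.
  move: Sy Tz; rewrite t_eq0 => /conic_weight0-> /conic_weight0->.
  by rewrite subrr; apply: cone0.
have DT v : S v -> forall (r : R) x, conic T r x -> cone D (r *: v - x).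
  move=> Sv; apply: conic_ind => [|l r p x Tp l0 IH].
    by rewrite scale0r subrr; apply: cone0.
  rewrite scalerDl opprD addrACA -scalerBr; apply: coneD => //.
  by apply: coneZ => //; apply: sub_cone; exists v => //; exists p.
have : cone D (t *: y - t *: z).
  (* Only the weight of [y] is generalized, to some [r]: the claim becomes
     [cone D (t *: y - r *: z)], where the factor [t] of [y] stays the weight of [z], as [DT]
     requires. *)
  move: {1 3}t y Sy; apply: conic_ind => [|l r p x Sp l0 IH].
    by rewrite scaler0 scale0r subrr; apply: cone0.
  rewrite scalerDr scalerDl opprD addrACA; apply: coneD => //.
  by rewrite scalerA mulrC -scalerA -scalerBr; apply: coneZ => //; apply: DT.
rewrite -scalerBr => /(coneZ _ t^-1).
by rewrite invr_ge0 scalerA mulVf // scale1r; apply.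
Qed.

End BisectionCone.

Theorem proposition3p2 (R : realType) (d : nat) (P F G : set 'rV[R]_d)
    (hP : polytope P) (hdim : has_dim P d%:Z) (hsym : [set - x | x in P] = P)
    (hF : facet P F) (hG : facet P G) :
  bisection_cone P F G = cone [set v - u | v in vert F & u in vert G].
Proof.
have P0 : P !=set0.
  apply/set0P/eqP => P0.
  by have := has_dim_uniq _ _ _ hdim (or_introl (conj P0 erefl)).
have [c [Pc FE]] := facet_normal _ _ hsym P0 hF.
have [e [Pe GE]] := facet_normal _ _ hsym P0 hG.
have distF := dist_conic _ _ _ hP P0 Pc FE.
have distG := dist_conic _ _ _ hP P0 Pe GE.
have vertS (S : set 'rV[R]_d) v : vert S v -> S v.
  by move=> [n [beta [_ /seteqP[/(_ v erefl)[]]]]].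
have vertF f S (t : R) x : S = P `&` [set x | dot f x = 1] ->
    (forall x, P x -> dot f x <= 1) -> conic S t x -> conic (vert S) t x.
  move=> SE Pf Sx; have S1 p : S p -> dot f p = 1 by rewrite SE => -[].
  have /coneP[r vx] : cone (vert S) x.
    by apply: (cone_face _ _ _ hP Pf SE); apply/coneP; exists t.
  (* Both weights equal [dot f x], so passing to vertices keeps the weight. *)
  rewrite -(dot_conic _ _ S1 _ _ Sx).
  by rewrite (dot_conic _ _ (fun p vp => S1 p (vertS _ _ vp)) _ _ vx).
apply/seteqP; split=> [x [y [[yE [y' /coneP[t Fy] y'E]] [z /coneP[r Gz] zE]]]|x].
  rewrite addr0 in y'E; subst y'.
  have zE' : z = y - x by rewrite -zE addrK.
  (* The weights are the distances of [y] from 0 and from [x], which agree on the bisector. *)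
  have rt : r = t.
    move: yE; rewrite /bis /= (distF t) ?subr0 // (distG r) -?zE' //; exact: esym.
  rewrite rt in Gz; have -> : x = y - z by rewrite -zE addrAC subrr add0r.
  by apply: (cone_sub _ _ t); [apply: (vertF c)|apply: (vertF e)].
move=> /coneP[t xt].
have [y [z [Fy Gz ->]]] : exists y z, [/\ conic F t y, conic G t z & x = y - z].
  move: t x xt; apply: conic_ind => [|l t _ _ [v Fv [u Gu <-]] l0 [y [z [Fy Gz ->]]]].
    by exists 0, 0; split; rewrite ?subr0 //; apply: conic0.
  exists (l *: v + y), (l *: u + z); split; try by apply: conic_cons => //; apply: vertS.
  by rewrite scalerBr opprD addrACA.
(* As [y = x + z], the point [y] lies in both translated cones, at distance [t] from each apex. *)
exists y; split; [split|].
- by rewrite /bis /= (distF t) ?subr0 // (distG t) // opprB addrC subrK.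
- by exists y; rewrite ?addr0 //; apply/coneP; exists t.
- by exists z; [apply/coneP; exists t|rewrite addrC subrK].
Qed.
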